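(* Let $(\mathscr{X},\|\cdot\|)$ be a real normed space, let $p\in[0,1]$ and let $q>0$ be a real number. Then for all nonzero elements $x$ and $y$ in $\mathscr{X}$, $$\alpha_{p}[x,y]\leq 2^{1+\frac{1}{q}}\, \frac {\|x-y\|}{\left(\|x\|^{(1-p)q}+\|y\|^{(1-p)q}\right)^{\frac{1}{q}}}.$$
   Context: For $p\in\mathbb{R}$ and nonzero elements $x,y$ of a normed space $(\mathscr{X},\|\cdot\|)$, the $p$-angular distance is $$\alpha_{p}[x,y]:=\left\|\frac{x}{\|x\|^{1-p}}-\frac{y}{\|y\|^{1-p}}\right\|.$$ *)

(* Defs.v *)
From mathcomp Require Import all_boot all_order all_algebra.
From mathcomp Require Import all_classical all_reals all_analysis.
Set Implicit Arguments.
Unset Strict Implicit.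
Unset Printing Implicit Defensive.
Import Order.TTheory GRing.Theory Num.Theory.
Import numFieldNormedType.Exports.
Local Open Scope ring_scope.

(* The value is meaningful only for nonzero x and y. *)
Definition angular_dist (R : realType) (V : normedModType R) (p : R)
    (x y : V) : R :=
  `| (`|x| `^ (1 - p))^-1 *: x - (`|y| `^ (1 - p))^-1 *: y |.

(* Main.v *)
(** Let [s = 1 - p] and suppose [`|y| <= `|x|].  Splitting
    [x/|x|^s - y/|y|^s = (x - y)/|x|^s + (1/|x|^s - 1/|y|^s) y] bounds the
    distance by [2 |x - y| / |x|^s], because [|y| |x|^s <= |x| |y|^s] for
    [s <= 1].  The denominator of the claim is at most [2^(1/q) |x|^s]. *)
Require Import Defs.
From mathcomp Require Import all_boot all_order all_algebra.
From mathcomp Require Import all_classical all_reals all_analysis.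
Import Order.TTheory GRing.Theory Num.Theory.
Import numFieldNormedType.Exports.
Local Open Scope ring_scope.

Lemma angular_distC (R : realType) (V : normedModType R) (p : R) (x y : V) :
  angular_dist p x y = angular_dist p y x.
Proof. exact: distrC. Qed.

(** Factor [c = c^(1-s) * c^s] for [c = a, b]; cancelling the common positive factor [a^s * b^s]
    leaves [b^(1-s) <= a^(1-s)], where [1 - s >= 0]. *)
Lemma mulr_powR_le (R : realType) (s a b : R) :
  s <= 1 -> 0 < b -> b <= a -> b * a `^ s <= a * b `^ s.
Proof.
move=> s1 b0 ba; have a0 := lt_le_trans b0 ba.
have split_powR c : 0 < c -> c = c `^ (1 - s) * c `^ s.
  move=> c0; rewrite -powRD; first by rewrite subrK powRr1 ?ltW.
  by rewrite (gt_eqF c0) implybT.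
rewrite [X in X * _ <= _]split_powR// [X in _ <= X * _]split_powR//.
rewrite mulrAC ler_pM2r ?powR_gt0// ler_pM2r ?powR_gt0//.
by rewrite ge0_ler_powR ?nnegrE ?subr_ge0 ?(ltW a0) ?(ltW b0).
Qed.

Lemma angular_dist_le_max (R : realType) (V : normedModType R) (p : R)
    (x y : V) :
  0 <= p -> p <= 1 -> y != 0 -> `|y| <= `|x| ->
  angular_dist p x y <= 2 * (`|x - y| / `|x| `^ (1 - p)).
Proof.
move=> p0 p1 y0 yx; have b0 : 0 < `|y| by rewrite normr_gt0.
have a0 := lt_le_trans b0 yx.
have s1 : 1 - p <= 1 by rewrite gerBl.
have buav := mulr_powR_le _ _ _ _ s1 b0 yx.
have vu : `|y| `^ (1 - p) <= `|x| `^ (1 - p).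
  by rewrite ge0_ler_powR ?nnegrE ?subr_ge0 ?(ltW a0) ?(ltW b0).
have u0 : 0 < `|x| `^ (1 - p) by rewrite powR_gt0.
have v0 : 0 < `|y| `^ (1 - p) by rewrite powR_gt0.
rewrite /angular_dist.
move: (`|x| `^ _) (`|y| `^ _) => u v in buav vu u0 v0 *.
have -> : u^-1 *: x - v^-1 *: y = u^-1 *: (x - y) + (u^-1 - v^-1) *: y.
  by rewrite scalerBr scalerBl addrA subrK.
apply: le_trans (ler_normD _ _) _.
rewrite !normrZ (gtr0_norm (x := u^-1)) ?invr_gt0//.
rewrite ler0_norm ?subr_le0 ?lef_pV2// opprB.
rewrite mulr_natl mulr2n [u^-1 * _]mulrC lerD2l.
(* The reverse triangle inequality allows replacing [|x - y|] by [|x| - |y|]. Then [|y| / u] is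
   subtracted on both sides, and what remains, [|y| / v <= |x| / u], is [buav]. *)
apply: (@le_trans _ _ ((`|x| - `|y|) / u)); last first.
  by rewrite ler_pM2r ?invr_gt0// (le_trans (ler_norm _)) ?ler_dist_dist.
rewrite mulrBl mulrBl lerB// 1?mulrC//.
by rewrite ler_pdivrMr// mulrAC ler_pdivlMr.
Qed.

(** The right side is [(2 * a^(s*q))^(1/q)], so monotonicity of the power [1/q] reduces the claim to
    [b^(s*q) <= a^(s*q)]. *)
Lemma powR_mean_le (R : realType) (s q a b : R) :
  0 <= s -> 0 < q -> 0 < b -> b <= a ->
  (a `^ (s * q) + b `^ (s * q)) `^ (1 / q) <= 2 `^ (1 / q) * a `^ s.
Proof.
move=> s0 q0 b0 ba; have a0 := lt_le_trans b0 ba.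
have -> : a `^ s = (a `^ (s * q)) `^ (1 / q).
  by rewrite -powRrM mul1r mulfK ?gt_eqF.
rewrite -powRM ?powR_ge0//.
rewrite ge0_ler_powR ?nnegrE ?divr_ge0 ?addr_ge0 ?mulr_ge0 ?powR_ge0 ?(ltW q0)//.
rewrite mulrDl mul1r lerD2l.
by rewrite ge0_ler_powR ?nnegrE ?mulr_ge0 ?(ltW a0) ?(ltW b0) ?(ltW q0).
Qed.

Theorem theorem2p2 (R : realType) (V : normedModType R) (p q : R)
    (hp0 : 0 <= p) (hp1 : p <= 1) (hq : 0 < q)
    (x y : V) (hx : x != 0) (hy : y != 0) :
  angular_dist p x y <=
    2 `^ (1 + 1 / q) *
      (`|x - y| /
        (`|x| `^ ((1 - p) * q) + `|y| `^ ((1 - p) * q)) `^ (1 / q)).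
Proof.
(* Both sides are symmetric in [x] and [y]. *)
wlog yx : x y hx hy / `|y| <= `|x|.
  move=> H; have [|/ltW] := leP `|y| `|x|; first exact: H.
  by rewrite angular_distC distrC [X in X `^ (1 / q)]addrC; exact: H.
apply: le_trans (angular_dist_le_max _ _ _ _ _ hp0 hp1 hy yx) _.
have x0 : 0 < `|x| by rewrite normr_gt0.
have y0 : 0 < `|y| by rewrite normr_gt0.
have p1 : 0 <= 1 - p by rewrite subr_ge0.
have := powR_mean_le _ _ _ _ _ p1 hq y0 yx.
(* Splitting [2^(1 + 1/q) = 2 * 2^(1/q)], the factor [2] cancels against the one from
   [angular_dist_le_max]; [2^(1/q)] is the constant of [powR_mean_le]. *)
rewrite [2 `^ (1 + _)]powRD ?pnatr_eq0 ?implybT// powRr1// -mulrA ler_pM2l//.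
have D0 : 0 < (`|x| `^ ((1 - p) * q) + `|y| `^ ((1 - p) * q)) `^ (1 / q).
  by rewrite powR_gt0 ?addr_gt0 ?powR_gt0.
move=> Dle; rewrite mulrCA ler_wpM2l//.
by rewrite ler_pdivlMr// mulrC ler_pdivrMr ?powR_gt0.
Qed.
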